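(* Let $\mathcal{A}$ be a nonempty upward closed collection of Turing degrees with a countable (finite or countably infinite) basis $\mathcal{B}$. Then there is a pair $(R,S)$ of equivalence relations on $\omega$, neither of which has an infinite equivalence class, such that $\mathrm{DgSp}_{\Leftrightarrow}(R,S)=\mathcal{A}$.
   Context: For equivalence relations $R,S$ on $\omega$ and a Turing degree $\mathbf{d}$, write $R\leq_{\mathbf{d}} S$ if there is a $\mathbf{d}$-computable function $f:\omega\to\omega$ such that for all $x,y\in\omega$, $x R y \Leftrightarrow f(x) S f(y)$; write $R\equiv_{\mathbf{d}} S$ if $R\leq_{\mathbf{d}} S$ and $S\leq_{\mathbf{d}} R$. The bi-reducibility spectrum of $(R,S)$ is $\mathrm{DgSp}_{\Leftrightarrow}(R,S)=\{\mathbf{d} : R\equiv_{\mathbf{d}} S\}$. A collection $\mathcal{A}$ of Turing degrees is upward closed if $\mathbf{a}\in\mathcal{A}$ and $\mathbf{a}\leq\mathbf{d}$ imply $\mathbf{d}\in\mathcal{A}$. A set $\mathcal{B}$ of Turing degrees is a basis of $\mathcal{A}$ if (1) the elements of $\mathcal{B}$ are pairwise Turing-incomparable, and (2) $\mathcal{A}=\{\mathbf{d} : (\exists \mathbf{b}\in\mathcal{B})(\mathbf{b}\leq\mathbf{d})\}$. *)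

(* Defs.v *)
From mathcomp Require Import all_boot.
From mathcomp Require Import all_classical.

Set Implicit Arguments.
Unset Strict Implicit.
Unset Printing Implicit Defensive.

Local Open Scope classical_set_scope.

(* Kleene's mu-recursive functions with an oracle: [rcode n] is the type of
   programs taking n arguments. *)
Inductive rcode : nat -> Type :=
| RZero : rcode 0
| RSucc : rcode 1
| RProj n (i : 'I_n) : rcode n
| ROracle : rcode 1
| RComp m n (f : rcode m) (g : 'I_m -> rcode n) : rcode n
| RPrec n (f : rcode n) (g : rcode n.+2) : rcode n.+1
| RMu n (f : rcode n.+1) : rcode n.

(* A partial function is given by its graph: [reval O c x y] says that the
   program c with oracle O halts on the arguments x with output y.
   - [RPrec f g] is h with h(0, x) = f(x) and h(k+1, x) = g(k, h(k, x), x).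
   - [RMu f] maps x to the least y with f(y, x) = 0, provided that f(z, x) is
     defined (and nonzero) for all z < y. *)
Fixpoint reval (O : pred nat) n (c : rcode n) : n.-tuple nat -> nat -> Prop :=
  match c in rcode n return n.-tuple nat -> nat -> Prop with
  | RZero => fun _ y => y = 0
  | RSucc => fun x y => y = (thead x).+1
  | RProj _ i => fun x y => y = tnth x i
  | ROracle => fun x y => y = nat_of_bool (O (thead x))
  | RComp m _ f g => fun x y =>
      exists2 u : m.-tuple nat,
        (forall i : 'I_m, reval O (g i) x (tnth u i)) & reval O f u y
  | RPrec n f g => fun x y =>
      let fix h (k : nat) (z : nat) : Prop :=
        if k is k'.+1 then
          exists2 w, h k' w & reval O g [tuple of k' :: w :: behead x] z
        else reval O f [tuple of behead x] z in
      h (thead x) y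
  | RMu n f => fun x y =>
      reval O f [tuple of y :: x] 0 /\
      (forall z, z < y -> exists w, reval O f [tuple of z :: x] w.+1)
  end.

Definition computable_in (O : pred nat) (f : nat -> nat) : Prop :=
  exists c : rcode 1, forall x, reval O c [tuple x] (f x).

Definition turing_le (X Y : pred nat) : Prop :=
  computable_in Y (fun x => nat_of_bool (X x)).

Definition turing_eq (X Y : pred nat) : Prop := turing_le X Y /\ turing_le Y X.

(* A Turing degree is a class of the equivalence relation [turing_eq]. *)
Record degree := Degree {
  degree_class : set (pred nat);
  degree_classP : exists X, degree_class = [set Y | turing_eq Y X]
}.

Definition degree_le (a b : degree) : Prop :=
  exists X Y, [/\ degree_class a X, degree_class b Y & turing_le X Y].

Definition degree_computable (d : degree) (f : nat -> nat) : Prop :=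
  exists2 X, degree_class d X & computable_in X f.

Definition upward_closed (A : set degree) : Prop :=
  forall a d, A a -> degree_le a d -> A d.

Definition is_basis (B A : set degree) : Prop :=
  (forall a b, B a -> B b -> a <> b -> ~ degree_le a b /\ ~ degree_le b a) /\
  A = [set d | exists2 b, B b & degree_le b d].

Definition reducible_in (d : degree) (R S : rel nat) : Prop :=
  exists2 f : nat -> nat,
    degree_computable d f & forall x y, R x y <-> S (f x) (f y).

Definition bireducible_in (d : degree) (R S : rel nat) : Prop :=
  reducible_in d R S /\ reducible_in d S R.

Definition bireducibility_spectrum (R S : rel nat) : set degree :=
  [set d | bireducible_in d R S].

Definition no_infinite_class (R : rel nat) : Prop :=
  forall x, finite_set [set y | R x y].

(* Main.v *)
(* Let X_0, X_1, ... represent the degrees of the basis, and write P_k for the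
   set of (codes of) finite prefixes of X_k; any unbounded list of elements of
   P_k computes X_k. With
     Z = {<k, s, t> : k < t, s in P_k, t in P_0},  Y = {<t, j> : t in P_0},
   let R and S have the pairs {2z, 2z + 1} with z in Z, resp. in the join of Z
   and Y, as their only nontrivial classes. Then R reduces to S computably, and
   X_k reduces S to R by <t, j> |-> <k, the prefix of X_k of length 2j + 1, t>,
   with the elements <k, s, t> of Z moved to prefixes of even length; this only
   leaves out the finitely many t <= k.

   Conversely, let f reduce S to R. If for each t in P_0 some pair <t, j> is
   collapsed by f to a point, then f enumerates P_0 and so computes X_0.
   Otherwise some t in P_0 yields an injective sequence <k_j, s_j, t_j> in Z. If
   t_j is unbounded then f computes X_0; if not, k_j < t_j is bounded, hence s_j
   is unbounded along the j with k_j = k for some k, and f computes X_k. *)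
Require Import Defs.
From mathcomp Require Import all_boot.
From mathcomp Require Import all_classical.
From mathcomp Require Import zify.

Set Implicit Arguments.
Unset Strict Implicit.
Unset Printing Implicit Defensive.

Local Open Scope classical_set_scope.

(** * The Cantor pairing function *)

Definition triangular r := (r * r.+1)./2.

Lemma triangularS r : triangular r.+1 = triangular r + r.+1.
Proof.
rewrite /triangular; have -> : r.+1 * r.+2 = r * r.+1 + r.+1.*2 by lia.
by rewrite halfD odd_double andbF add0n doubleK.
Qed.

Lemma triangular_ge r : r <= triangular r.
Proof. by elim: r => // r IH; rewrite triangularS; lia. Qed.

Lemma triangular_mono r r' : r <= r' -> triangular r <= triangular r'.
Proof.
elim: r' => [|r' IH]; first by rewrite leqn0 => /eqP ->.
by rewrite leq_eqVlt => /orP[/eqP -> //|/IH]; rewrite triangularS; lia.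
Qed.

Definition cpair a b := triangular (a + b) + a.

Lemma triangular_above z : exists r, z < triangular r.+1.
Proof. by exists z; exact: triangular_ge. Qed.

(** The antidiagonal that contains [z], that is, the sum of the two components. *)
Definition croot z := ex_minn (triangular_above z).

Lemma crootP z : triangular (croot z) <= z < triangular (croot z).+1.
Proof.
rewrite /croot; case: ex_minnP => -[//|r] zr rmin; apply/andP; split => //.
by rewrite leqNgt; apply/negP => /rmin; rewrite ltnn.
Qed.

Definition cfst z := z - triangular (croot z).
Definition csnd z := croot z - cfst z.

Lemma croot_cpair a b : croot (cpair a b) = a + b.
Proof.
have /andP[] := crootP (cpair a b); set r := croot _; rewrite /cpair => rlo rhi.
apply/eqP; rewrite eqn_leq; apply/andP; split; rewrite leqNgt; apply/negP.
  by move=> /triangular_mono; rewrite triangularS; lia.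
by move=> /triangular_mono; lia.
Qed.

Lemma cfstK a b : cfst (cpair a b) = a.
Proof. by rewrite /cfst croot_cpair /cpair; lia. Qed.

Lemma csndK a b : csnd (cpair a b) = b.
Proof. by rewrite /csnd cfstK croot_cpair; lia. Qed.

Lemma cpairK z : cpair (cfst z) (csnd z) = z.
Proof.
have := crootP z; rewrite triangularS => /andP[h1 h2].
rewrite /cpair /csnd; have e : cfst z <= croot z by rewrite /cfst; lia.
by rewrite subnKC // /cfst; lia.
Qed.

(** * Closure properties of oracle computability *)

(** Taking [F] on sequences instead of tuples lets closure lemmas work on plain expressions in
    [nth 0 v i]. *)
Definition rcomputes (O : pred nat) n (F : seq nat -> nat) : Prop :=
  exists c : rcode n, forall v : n.-tuple nat, reval O c v (F v).

Lemma tuple1_eta (v : 1.-tuple nat) : v = [tuple thead v].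
Proof. by apply: val_inj; case/tupleP: v => x v; rewrite theadE (tuple0 v). Qed.

Lemma rcomputes1P O f :
  rcomputes O 1 (fun v => f (nth 0 v 0)) <-> computable_in O f.
Proof.
split=> -[c cP]; exists c; first by move=> x; exact: cP [tuple x].
by move=> v; rewrite (tuple1_eta v); exact: cP.
Qed.

Section Closure.
Variable O : pred nat.

Notation computes := (rcomputes O).

Lemma computes_comp n F (Gs : seq (seq nat -> nat)) :
  computes (size Gs) F -> (forall i, i < size Gs -> computes n (nth (fun=> 0) Gs i)) ->
  computes n (fun v => F [seq G v | G <- Gs]).
Proof.
move=> [c cP] GP.
have /choice[d dP] : forall i : 'I_(size Gs), exists d : rcode n,
    forall v : n.-tuple nat, reval O d v (nth (fun=> 0) Gs i v).
  by move=> i; exact: GP.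
exists (RComp c d) => v /=.
exists (map_tuple (fun G : seq nat -> nat => G v) (in_tuple Gs)).
  move=> i; rewrite tnth_map (tnth_nth (fun=> 0)); exact: dP.
exact: cP.
Qed.

Lemma computes_var n i : i < n -> computes n (fun v => nth 0 v i).
Proof.
by move=> lin; exists (RProj (Ordinal lin)) => v /=; rewrite (tnth_nth 0).
Qed.

Lemma computes_app1 n f F : computable_in O f -> computes n F ->
  computes n (fun v => f (F v)).
Proof.
move=> /rcomputes1P cf cF.
by apply: (@computes_comp n (fun v => f (nth 0 v 0)) [:: F]) => // -[|[]].
Qed.

Lemma computes_app2 n f F G : computes 2 (fun v => f (nth 0 v 0) (nth 0 v 1)) ->
  computes n F -> computes n G -> computes n (fun v => f (F v) (G v)).
Proof.
move=> cf cF cG.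
by apply: (@computes_comp n (fun v => f (nth 0 v 0) (nth 0 v 1)) [:: F; G]) =>
  // -[|[|[]]].
Qed.

Lemma computes_succ n F : computes n F -> computes n (fun v => (F v).+1).
Proof. by apply: (@computes_app1 n succn); exists RSucc. Qed.

Lemma computes_oracle n F : computes n F -> computes n (fun v => nat_of_bool (O (F v))).
Proof. by apply: (@computes_app1 n (fun x => nat_of_bool (O x))); exists ROracle. Qed.

Lemma computes_const n a : computes n (fun=> a).
Proof.
elim: a => [|a /computes_succ //].
by apply: (@computes_comp n (fun=> 0) [::]) => //; exists RZero.
Qed.

Lemma computes_prec n F G (h : nat -> seq nat -> nat) :
  computes n F -> computes n.+2 G ->
  (forall v, h 0 v = F v) ->
  (forall k v, h k.+1 v = G [:: k, h k v & v]) ->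
  computes n.+1 (fun v => h (head 0 v) (behead v)).
Proof.
move=> [c cP] [d dP] h0 hS; exists (RPrec c d) => v /=.
rewrite (_ : head 0 v = thead v); last by case/tupleP: v.
elim: (thead v) => [|k IH]; first by rewrite h0; exact: cP.
by exists (h k (behead v)) => //; rewrite hS; exact: dP.
Qed.

Lemma computes_prec1 f G :
  computes 2 G -> (forall k, f k.+1 = G [:: k; f k]) ->
  computable_in O f.
Proof.
move=> cG fS; apply/rcomputes1P.
have := @computes_prec 0 (fun=> f 0) (fun v => G [:: nth 0 v 0; nth 0 v 1])
  (fun k _ => f k) (computes_const _ _) _ (fun=> erefl) (fun k _ => fS k).
case; first apply: (@computes_comp 2 G [:: nth 0 ^~ 0; nth 0 ^~ 1]) => //.
  by case=> [|[|[]]] // _; exact: computes_var.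
move=> c cP; by exists c => v; have := cP v; case/tupleP: v.
Qed.

Lemma computes_prec2 f F G :
  computable_in O F -> computes 3 G -> (forall x, f 0 x = F x) ->
  (forall k x, f k.+1 x = G [:: k; f k x; x]) ->
  computes 2 (fun v => f (nth 0 v 0) (nth 0 v 1)).
Proof.
move=> /rcomputes1P cF cG f0 fS.
have := @computes_prec 1 _ (fun v => G [:: nth 0 v 0; nth 0 v 1; nth 0 v 2])
  (fun k v => f k (nth 0 v 0)) cF _ (fun=> f0 _) (fun k _ => fS k _).
case; first apply: (@computes_comp 3 G [:: nth 0 ^~ 0; nth 0 ^~ 1; nth 0 ^~ 2]) => //.
  by case=> [|[|[|[]]]] // _; exact: computes_var.
by move=> c cP; exists c => v; have := cP v; case/tupleP: v.
Qed.

(** [RMu] searches for a zero, hence the negated test. *)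
Lemma computes_mu n (b : seq nat -> bool) h :
  computes n.+1 (fun v => nat_of_bool (~~ b v)) ->
  (forall v, b (h v :: v)) -> (forall v z, z < h v -> ~~ b (z :: v)) ->
  computes n h.
Proof.
move=> [c cP] bh bmin; exists (RMu c) => v /=; split.
  by have := cP [tuple of h v :: v]; rewrite /= bh.
by move=> z /bmin bz; exists 0; have := cP [tuple of z :: v]; rewrite /= bz.
Qed.

Lemma computes_add n F G : computes n F -> computes n G ->
  computes n (fun v => F v + G v).
Proof.
apply: (@computes_app2 n addn).
apply: (@computes_prec2 addn id (fun v => (nth 0 v 1).+1)) => //.
  by apply/rcomputes1P; exact: computes_var.
exact/computes_succ/computes_var.
Qed.

Lemma computes_pred n F : computes n F -> computes n (fun v => (F v).-1).
Proof.
apply: (@computes_app1 n predn); apply: (@computes_prec1 predn (nth 0 ^~ 0)) => //.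
exact: computes_var.
Qed.

Lemma computes_sub n F G : computes n F -> computes n G ->
  computes n (fun v => F v - G v).
Proof.
(* Recursion runs on the first argument, so the subtrahend is put first. *)
move=> cF cG; apply: (@computes_app2 n (fun x y => y - x) G F) => //.
apply: (@computes_prec2 (fun x y => y - x) id (fun v => (nth 0 v 1).-1)) => [| | |k x].
- by apply/rcomputes1P; exact: computes_var.
- exact/computes_pred/computes_var.
- exact: subn0.
- by rewrite subnS.
Qed.

Lemma computes_mul n F G : computes n F -> computes n G ->
  computes n (fun v => F v * G v).
Proof.
apply: (@computes_app2 n muln).
apply: (@computes_prec2 muln (fun=> 0) (fun v => nth 0 v 2 + nth 0 v 1)) => //.
  by apply/rcomputes1P; exact: computes_const.
by apply: computes_add; exact: computes_var.
Qed.

Lemma computes_negb n (b : seq nat -> bool) :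
  computes n (fun v => nat_of_bool (b v)) ->
  computes n (fun v => nat_of_bool (~~ b v)).
Proof.
move=> cb; have := computes_sub (computes_const n 1) cb.
by congr rcomputes; apply/funext => v; case: (b v).
Qed.

Lemma computes_andb n (b b' : seq nat -> bool) :
  computes n (fun v => nat_of_bool (b v)) ->
  computes n (fun v => nat_of_bool (b' v)) ->
  computes n (fun v => nat_of_bool (b v && b' v)).
Proof.
move=> cb cb'; have := computes_mul cb cb'.
by congr rcomputes; apply/funext => v; case: (b v) (b' v) => [] [].
Qed.

Lemma computes_leq n F G : computes n F -> computes n G ->
  computes n (fun v => nat_of_bool (F v <= G v)).
Proof.
move=> cF cG; have := computes_sub (computes_const n 1) (computes_sub cF cG).
by congr rcomputes; apply/funext => v; case: leqP; lia.
Qed.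

Lemma computes_eq n F G : computes n F -> computes n G ->
  computes n (fun v => nat_of_bool (F v == G v)).
Proof.
move=> cF cG; have := computes_andb (computes_leq cF cG) (computes_leq cG cF).
by congr rcomputes; apply/funext => v; rewrite eqn_leq.
Qed.

Lemma computes_if n (b : seq nat -> bool) F G :
  computes n (fun v => nat_of_bool (b v)) -> computes n F -> computes n G ->
  computes n (fun v => if b v then F v else G v).
Proof.
move=> cb cF cG; have := computes_add (computes_mul cb cF)
  (computes_mul (computes_negb cb) cG).
by congr rcomputes; apply/funext => v; case: (b v) => /=; lia.
Qed.

Lemma computes_half n F : computes n F -> computes n (fun v => (F v)./2).
Proof.
apply: (@computes_app1 n half).
(* The recursion rests on [k./2 + k.+1./2 = k]. *)
apply: (@computes_prec1 half (fun v => nth 0 v 0 - nth 0 v 1)).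
  by apply: computes_sub; exact: computes_var.
by move=> k /=; lia.
Qed.

Lemma computes_odd n F : computes n F -> computes n (fun v => nat_of_bool (odd (F v))).
Proof.
apply: (@computes_app1 n (fun x => nat_of_bool (odd x))).
apply: (@computes_prec1 (fun x => nat_of_bool (odd x)) (fun v => 1 - nth 0 v 1)).
  by apply: computes_sub; [exact: computes_const|exact: computes_var].
by move=> k /=; case: odd.
Qed.

Lemma computes_double n F : computes n F -> computes n (fun v => (F v).*2).
Proof.
move=> cF; have := computes_add cF cF.
by congr rcomputes; apply/funext => v; rewrite addnn.
Qed.

Lemma computes_iter_half n F G : computes n F -> computes n G ->
  computes n (fun v => iter (F v) half (G v)).
Proof.
apply: (@computes_app2 n (fun m x => iter m half x)).
apply: (@computes_prec2 (fun m x => iter m half x) id (fun v => (nth 0 v 1)./2)) => //.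
  by apply/rcomputes1P; exact: computes_var.
exact/computes_half/computes_var.
Qed.

Lemma computes_triangular n F :
  computes n F -> computes n (fun v => triangular (F v)).
Proof. by move=> cF; apply/computes_half/computes_mul => //; exact: computes_succ. Qed.

Lemma computes_cpair n F G : computes n F -> computes n G ->
  computes n (fun v => cpair (F v) (G v)).
Proof.
by move=> cF cG; apply: computes_add => //; apply/computes_triangular/computes_add.
Qed.

Lemma computes_croot n F : computes n F -> computes n (fun v => croot (F v)).
Proof.
apply: (@computes_app1 n croot); apply/rcomputes1P.
apply: (@computes_mu 1 (fun v => nth 0 v 1 < triangular (nth 0 v 0).+1)).
- apply/computes_negb/computes_leq; first exact/computes_succ/computes_var.
  exact/computes_triangular/computes_succ/computes_var.
- by move=> v /=; have /andP[] := crootP (nth 0 v 0).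
- move=> v z zr /=; rewrite -leqNgt.
  apply: leq_trans (triangular_mono zr) _.
  by have /andP[] := crootP (nth 0 v 0).
Qed.

Lemma computes_cfst n F : computes n F -> computes n (fun v => cfst (F v)).
Proof.
by move=> cF; apply: computes_sub => //; exact/computes_triangular/computes_croot.
Qed.

Lemma computes_csnd n F : computes n F -> computes n (fun v => csnd (F v)).
Proof.
by move=> cF; apply: computes_sub; [exact: computes_croot|exact: computes_cfst].
Qed.

(* Finitely many values can be hard-wired into a program. *)
Lemma computes_bounded n (P : pred nat) m F : computes n F ->
  computes n (fun v => nat_of_bool ((F v <= m) && P (F v))).
Proof.
apply: (@computes_app1 n (fun x => nat_of_bool ((x <= m) && P x))).
apply/rcomputes1P; elim: m => [|m IH].
  have : computes 1 (fun v => nat_of_bool ((nth 0 v 0 == 0) && P 0)).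
    by apply: computes_andb; [apply: computes_eq; [exact: computes_var|]|];
      exact: computes_const.
  by congr rcomputes; apply/funext => v; rewrite leqn0; case: eqP => // ->.
have : computes 1 (fun v => if nth 0 v 0 == m.+1 then nat_of_bool (P m.+1) else
    nat_of_bool ((nth 0 v 0 <= m) && P (nth 0 v 0))).
  apply: computes_if => //; last exact: computes_const.
  by apply: computes_eq; [exact: computes_var|exact: computes_const].
by congr rcomputes; apply/funext => v; rewrite [_ <= m.+1]leq_eqVlt ltnS;
  case: eqP => // ->.
Qed.

End Closure.

(** Each oracle call is replaced by the program [o] that decides [X] from [Y]. *)
Lemma computable_in_trans X Y f : turing_le X Y -> computable_in X f ->
  computable_in Y f.
Proof.
move=> [o oP] [c cP]; suff : forall k (c : rcode k), exists c' : rcode k,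
    forall v y, reval X c v y -> reval Y c' v y.
  by move=> /(_ _ c)[c' cc']; exists c' => x; exact: cc'.
move=> k; elim=> {f k c cP}.
- by exists RZero.
- by exists RSucc.
- by move=> n i; exists (RProj i).
- by exists o => v y /= ->; rewrite (tuple1_eta v) theadE; exact: oP.
- move=> m n f [f' ff'] g /choice[g' gg']; exists (RComp f' g') => v y /= [u gu fu].
  by exists u => [i|]; [exact/gg'/gu|exact: ff'].
- move=> n f [f' ff'] g [g' gg']; exists (RPrec f' g') => v y /=.
  elim: (thead v) y => [|j IH] y /=; first exact: ff'.
  by case=> w /IH w' /gg'; exists w.
- move=> n f [f' ff']; exists (RMu f') => v y /= [/ff' f0 fz]; split=> // z /fz[w /ff'].
  by exists w.
Qed.

(** The rule for a constant bound precedes the general one for [&&]: it hard-wires a predicate that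
    the oracle may be unable to compute. *)
Ltac computes_step :=
  lazymatch goal with
  | |- rcomputes _ _ (fun v => nth 0 v _) => exact: computes_var
  | |- rcomputes _ _ (fun=> ?a) => exact: computes_const
  | |- rcomputes _ _ (fun v => if _ then _ else _) => apply: computes_if
  | |- rcomputes _ _ (fun v => nat_of_bool ((_ <= ?m) && _)) =>
      apply: computes_bounded
  | |- rcomputes _ _ (fun v => nat_of_bool (_ && _)) => apply: computes_andb
  | |- rcomputes _ _ (fun v => nat_of_bool (~~ _)) => apply: computes_negb
  | |- rcomputes _ _ (fun v => nat_of_bool (_ == _)) => apply: computes_eq
  | |- rcomputes _ _ (fun v => nat_of_bool (_ <= _)) => apply: computes_leq
  | |- rcomputes _ _ (fun v => nat_of_bool (odd _)) => apply: computes_odd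
  | |- rcomputes ?O _ (fun v => nat_of_bool (?O _)) => apply: computes_oracle
  | |- rcomputes _ _ (fun v => cfst _) => apply: computes_cfst
  | |- rcomputes _ _ (fun v => csnd _) => apply: computes_csnd
  | |- rcomputes _ _ (fun v => cpair _ _) => apply: computes_cpair
  | |- rcomputes _ _ (fun v => iter _ half _) => apply: computes_iter_half
  | |- rcomputes _ _ (fun v => _.*2) => apply: computes_double
  | |- rcomputes _ _ (fun v => _./2) => apply: computes_half
  | |- rcomputes _ _ (fun v => _.+1) => apply: computes_succ
  | |- rcomputes _ _ (fun v => _ + _) => apply: computes_add
  | _ => assumption
  end.

Ltac computes := repeat computes_step.

(** * Codes of finite prefixes *)

(* The binary numeral of [1, X 0, ..., X (p - 1)]; the leading [1] records the
   length, so that halving drops the last bit. *)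
Fixpoint prefix_code (X : pred nat) p :=
  if p is p'.+1 then (prefix_code X p').*2 + X p' else 1.

Definition is_prefix_code X s := `[< exists p, prefix_code X p = s >].

Lemma is_prefix_codeP X p : is_prefix_code X (prefix_code X p).
Proof. by apply/asboolP; exists p. Qed.

Lemma prefix_code_gt X p : p < prefix_code X p.
Proof. by elim: p => //= p IH; lia. Qed.

Lemma prefix_code_ltn X : {homo prefix_code X : p q / p < q}.
Proof.
by apply: homo_ltn => [p q r|p]; [exact: ltn_trans|have := prefix_code_gt X p => /=; lia].
Qed.

Lemma prefix_code_mono X : {mono prefix_code X : p q / p <= q}.
Proof. exact/leq_mono/prefix_code_ltn. Qed.

Lemma prefix_code_inj X : injective (prefix_code X).
Proof. exact/incn_inj/prefix_code_mono. Qed.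

Lemma iter_half0 m : iter m half 0 = 0.
Proof. by elim: m => //= m ->. Qed.

(** Each halving drops a bit; once the leading 1 is gone, only 0 remains. *)
Lemma iter_half_prefix_code X m q :
  iter m half (prefix_code X q) = if m <= q then prefix_code X (q - m) else 0.
Proof.
elim: m q => [|m IH] [|q] //; rewrite iterSr /=; first by rewrite iter_half0.
by rewrite addnC half_bit_double IH ltnS subSS.
Qed.

Lemma computes_prefix_code X n F : rcomputes X n F ->
  rcomputes X n (fun v => prefix_code X (F v)).
Proof.
apply: (@computes_app1 X n (prefix_code X)).
apply: (@computes_prec1 _ _ (fun v => (nth 0 v 1).*2 + X (nth 0 v 0))) => //.
by computes.
Qed.

(** Codes increase with the length, so the only candidate for [s] is the first code that reaches
    [s]; [lg s] is its length. *)
Lemma computes_is_prefix_code X n F : rcomputes X n F ->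
  rcomputes X n (fun v => nat_of_bool (is_prefix_code X (F v))).
Proof.
apply: (@computes_app1 X n (fun s => nat_of_bool (is_prefix_code X s))).
have ex s : exists p, s <= prefix_code X p by exists s; exact/ltnW/prefix_code_gt.
pose lg s := ex_minn (ex s).
have clg : rcomputes X 1 (fun v => lg (nth 0 v 0)).
  apply: (@computes_mu X 1 (fun v => nth 0 v 1 <= prefix_code X (nth 0 v 0))).
  - by computes; apply: computes_prefix_code; computes.
  - by move=> v; rewrite /lg /=; case: ex_minnP.
  - move=> v z; rewrite /lg /=; case: ex_minnP => p _ pmin zp.
    by apply/negP => /pmin; rewrite leqNgt zp.
apply/rcomputes1P.
suff -> : (fun v : seq nat => nat_of_bool (is_prefix_code X (nth 0 v 0))) =
    (fun v => nat_of_bool (prefix_code X (lg (nth 0 v 0)) == nth 0 v 0)).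
  by computes; apply: computes_prefix_code.
apply/funext => v; congr nat_of_bool; apply/asboolP/eqP => [[p <-]|<-]; last by eexists.
rewrite /lg; case: ex_minnP => q pq /(_ p (leqnn _)) qp.
by congr prefix_code; apply/eqP; rewrite eqn_leq qp -(prefix_code_mono X).
Qed.

(* Each prefix contains all the shorter ones, so any unbounded list of prefixes
   computes the set. *)
Lemma turing_le_unbounded_prefixes X O e :
  computable_in O e -> (forall j, e j != 0 -> is_prefix_code X (e j)) ->
  (forall N, exists j, N < e j) -> turing_le X O.
Proof.
move=> ce eP eN.
(* Here [t] codes a list index and a number of final bits to drop. *)
pose v t := iter (csnd t) half (e (cfst t)).
(* Only the empty prefix has code 1, so the test detects length exactly [n.+1]; entries 0 of the
   list fail it. *)
have vP t n : iter n.+1 half (v t) = 1 -> v t = prefix_code X n.+1.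
  rewrite /v -iterD; case: (eqVneq (e (cfst t)) 0) => [->|/eP/asboolP[q <-]].
    by rewrite iter_half0.
  rewrite !iter_half_prefix_code; case: (leqP (n.+1 + csnd t) q) => // le1.
  case: (posnP (q - (n.+1 + csnd t))) => [e0 _|gt0].
    by rewrite ifT; [congr prefix_code|]; lia.
  by move: (prefix_code_gt X (q - (n.+1 + csnd t))) => h1 h2; exfalso; lia.
have ex n : exists t, iter n.+1 half (v t) == 1.
  have [j ltj] := eN (prefix_code X n).
  have /eP/asboolP[q eq] : e j != 0 by lia.
  move: ltj; rewrite -eq => ltj.
  have {}ltj : n < q by rewrite ltnNge -(prefix_code_mono X) -ltnNge.
  exists (cpair j (q - n.+1)); rewrite /v csndK cfstK -iterD -eq.
  by rewrite subnKC // iter_half_prefix_code leqnn subnn.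
pose h n := ex_minn (ex n).
have ch : rcomputes O 1 (fun v => h (nth 0 v 0)).
  apply: (@computes_mu O 1 (fun u => iter (nth 0 u 1).+1 half (v (nth 0 u 0)) == 1)).
  - by rewrite /v; computes; apply: computes_app1 => //; computes.
  - by move=> u; rewrite /h /=; case: ex_minnP.
  - move=> u z; rewrite /h; case: ex_minnP => p _ pmin zp.
    by apply/negP => /pmin; rewrite leqNgt zp.
apply/rcomputes1P.
suff -> : (fun u : seq nat => nat_of_bool (X (nth 0 u 0))) =
    (fun u => nat_of_bool (odd (v (h (nth 0 u 0))))).
  by rewrite /v; computes; apply: computes_app1 => //; computes.
(* The last bit of the prefix of length [n.+1] is [X n]. *)
apply/funext => u; rewrite /h; case: ex_minnP => p /eqP/vP -> _ /=.
by rewrite oddD odd_double oddb.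
Qed.

(** * Equivalence relations with classes of at most two elements *)

Definition pair_rel (P : pred nat) : rel nat :=
  fun x y => (x == y) || ((x./2 == y./2) && P x./2).

Lemma pair_rel_equivalence P : equivalence_rel (pair_rel P).
Proof.
move=> x y z; split; first by rewrite /pair_rel eqxx.
rewrite /pair_rel => /orP[/eqP -> //|/andP[/eqP xy Px]].
rewrite -xy Px !andbT; case: (eqVneq x z) => [<-|_] /=; last first.
  by case: (eqVneq y z) => [<-|_]; rewrite ?xy ?eqxx.
by rewrite eqxx orbT.
Qed.

Lemma pair_rel_no_infinite_class P : no_infinite_class (pair_rel P).
Proof.
move=> x; apply: (@sub_finite_set _ _ `I_x.+2); last exact: finite_II.
by move=> y /orP[/eqP ->|/andP[/eqP xy _]] /=; lia.
Qed.

Lemma pair_rel_double P w : pair_rel P w.*2 w.*2.+1 = P w.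
Proof.
rewrite /pair_rel (_ : w.*2.+1./2 = w); last by lia.
by rewrite doubleK eqxx /=; case: eqP => //; lia.
Qed.

(* [T w] says that the pair coded by [w] is collapsed to a point. *)
Lemma pair_rel_reduction P Q (h : nat -> nat) (T : pred nat) x y :
  injective h -> (forall w, P w = T w || Q (h w)) ->
  pair_rel P x y <->
  pair_rel Q ((h x./2).*2 + (if T x./2 then 0 else odd x))
             ((h y./2).*2 + (if T y./2 then 0 else odd y)).
Proof.
move=> inj_h PE.
have hlf z : ((h z./2).*2 + (if T z./2 then 0 else odd z))./2 = h z./2.
  by case: (T _); lia.
rewrite /pair_rel !hlf; split.
  move=> /orP[/eqP ->|/andP[/eqP <-]]; first by rewrite eqxx.
  by rewrite PE => /orP[->|->]; rewrite eqxx // orbT.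
move=> /orP[/eqP exy|/andP[/eqP/inj_h <- Qx]]; last by rewrite PE Qx eqxx !orbT.
(* Equal images come from a single pair; if [T] does not collapse it, the parities agree too and
   [x = y]. *)
have /inj_h half_xy : h x./2 = h y./2 by rewrite -hlf exy hlf.
rewrite half_xy eqxx PE /=; move: exy; rewrite half_xy.
by case: (T _) => /=; rewrite ?orbT // => ?; apply/orP; left; apply/eqP; lia.
Qed.

(** * The coded sets and the reductions in both directions *)

Arguments prefix_code : simpl never.

Section Coding.
Variable X : nat -> pred nat.

Definition coded_prefixes : pred nat := fun z =>
  let k := cfst z in let s := cfst (csnd z) in let t := csnd (csnd z) in
  [&& k < t, is_prefix_code (X k) s & is_prefix_code (X 0) t].

(** The second component of [w./2] for odd [w] is free: it gives each [t] infinitely many pairs. *)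
Definition coded_join : pred nat := fun w =>
  if odd w then is_prefix_code (X 0) (cfst w./2) else coded_prefixes w./2.

Lemma coded_prefixes_reducible O : exists2 f, computable_in O f &
  forall x y, pair_rel coded_prefixes x y <-> pair_rel coded_join (f x) (f y).
Proof.
exists (fun x => (x./2.*2).*2 + odd x); first by apply/rcomputes1P; computes.
move=> x y; apply: (@pair_rel_reduction _ _ double pred0) => [u v|w] /=; first by lia.
by rewrite /coded_join odd_double doubleK.
Qed.

Section Embedding.
Variable k : nat.

(* Codes with last component [0] are outside [coded_prefixes]; they receive the
   elements whose status is already decided. *)
Definition embedding w :=
  let z := w./2 in
  if odd w then
    if k < cfst z then
      cpair k (cpair (prefix_code (X k) (csnd z).*2.+1) (cfst z))
    else cpair w (cpair 0 0)
  else if csnd (csnd z) == 0 then cpair w (cpair 0 0)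
  else if cfst z == k then
    if is_prefix_code (X k) (cfst (csnd z)) then
      cpair k (cpair (prefix_code (X k) (cfst (csnd z)).*2) (csnd (csnd z)))
    else cpair w (cpair 0 0)
  else z.

(** These pairs, with [t <= k], have no counterpart of the form [<k, s, t>] in [coded_prefixes], so
    they are collapsed to points. *)
Definition settled w :=
  odd w && ((cfst w./2 <= k) && is_prefix_code (X 0) (cfst w./2)).

Lemma cpair_eqE a b a' b' : (cpair a b == cpair a' b') = (a == a') && (b == b').
Proof.
apply/eqP/andP => [e|[/eqP -> /eqP -> //]].
by have := congr1 cfst e; have := congr1 csnd e; rewrite !cfstK !csndK => -> ->.
Qed.

(** Images with last component 0 retain [w] in the first component. Among the others, those with
    first component [k] carry a prefix of odd length for odd [w] and of even length for even [w],
    the length determining [j] or [s]; the rest are unmoved and have first component other than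
    [k]. *)
Lemma embedding_inj : injective embedding.
Proof.
have dbl (a b : nat) : a./2 = b./2 -> odd a = odd b -> a = b by lia.
move=> a b; rewrite /embedding.
have := @dbl a b; move: (odd a) (odd b) (a./2) (b./2) => oa ob za zb.
rewrite -[za]cpairK -[zb]cpairK -(cpairK (csnd za)) -(cpairK (csnd zb)).
move: (cfst za) (cfst (csnd za)) (csnd (csnd za)) => ka sa ta.
move: (cfst zb) (cfst (csnd zb)) (csnd (csnd zb)) => kb sb tb.
rewrite !(cfstK, csndK) => {}dbl.
have {}dbl : oa = ob -> [&& ka == kb, sa == sb & ta == tb] -> a = b.
  by move=> oE /and3P[/eqP e1 /eqP e2 /eqP e3]; apply: dbl; rewrite // e1 e2 e3.
have pE := inj_eq (@prefix_code_inj (X k)).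
by case: oa ob dbl => [] [] dbl; repeat case: ifP => ?; move=> /eqP;
  rewrite !cpair_eqE ?pE ?eqSS ?(inj_eq double_inj) ?cpair_eqE; lia.
Qed.

Lemma coded_joinE w :
  coded_join w = settled w || coded_prefixes (embedding w).
Proof.
rewrite /coded_join /settled /embedding /coded_prefixes; case: ifP => ow /=.
  case: (leqP (cfst w./2) k) => [le_k|lt_k] /=; rewrite !cfstK !csndK ?cfstK ?csndK.
    by rewrite ltn0 orbF.
  (* The inserted prefix of [X k] is genuine and [k < t], so membership depends on [t] alone. *)
  by rewrite lt_k is_prefix_codeP.
set z := w./2; case: eqP => [->|/eqP tn0]; first by rewrite !cfstK !csndK !ltn0.
case: (eqVneq (cfst z) k) => [->|//].
by case: ifP => Ps; rewrite !cfstK !csndK ?cfstK ?csndK ?is_prefix_codeP ?ltn0 ?andbF.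
Qed.

Lemma coded_join_reducible : exists2 f, computable_in (X k) f &
  forall x y, pair_rel coded_join x y <-> pair_rel coded_prefixes (f x) (f y).
Proof.
eexists; last by move=> x y; apply: pair_rel_reduction embedding_inj coded_joinE.
apply/rcomputes1P; rewrite /embedding /settled.
(* [X 0] occurs only in [settled], under the bound [k], and is hard-wired there; everything else
   uses the oracle [X k]. *)
by computes; (try apply: computes_prefix_code);
  (try apply: computes_is_prefix_code); computes.
Qed.

End Embedding.
End Coding.

(** * Extracting some [X k] from a reduction *)

Lemma cpair_mono a b a' b' : a <= a' -> b <= b' -> cpair a b <= cpair a' b'.
Proof. by move=> aa bb; apply: leq_add => //; apply: triangular_mono; exact: leq_add. Qed.

Lemma injective_unbounded (z : nat -> nat) : injective z -> forall N, exists j, N < z j.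
Proof.
move=> inj_z N; apply: contrapT => /forallNP zN.
have zN1 j : z j < N.+1 by rewrite ltnS leqNgt; apply/negP.
have inj : injective (fun i : 'I_N.+2 => Ordinal (zN1 i)).
  by move=> i j [] /inj_z/val_inj.
by have := leq_card _ inj; rewrite !card_ord ltnn.
Qed.

Lemma coded_join_reduction_computes X O f : computable_in O f ->
  (forall x y, pair_rel (coded_join X) x y <->
               pair_rel (coded_prefixes X) (f x) (f y)) ->
  exists k, turing_le (X k) O.
Proof.
move=> cf fP.
pose w t j := (cpair t j).*2.+1.
have joinE t j : coded_join X (w t j) = is_prefix_code (X 0) t.
  by rewrite /coded_join /w /= odd_double /= uphalf_double cfstK.
pose A t j := f (w t j).*2; pose B t j := f (w t j).*2.+1.
(* Elements with the same image are equivalent, so a collapse certifies [t]. *)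
have collapsed t j : A t j = B t j -> is_prefix_code (X 0) t.
  move=> AB; rewrite -(joinE t j) -pair_rel_double; apply/fP.
  by rewrite -/(A t j) -/(B t j) AB /pair_rel eqxx.
case: (pselect (forall t, is_prefix_code (X 0) t -> exists j, A t j = B t j)) => [all_t|].
  (* The list shows [t] when the pair coded by [<t, j>] collapses, and 0 otherwise. *)
  exists 0; apply: (@turing_le_unbounded_prefixes _ _ (fun x =>
      if A (cfst x) (csnd x) == B (cfst x) (csnd x) then cfst x else 0)).
  - by apply/rcomputes1P; rewrite /A /B /w; computes; apply: computes_app1 => //; computes.
  - by move=> x; case: (eqVneq (A _ _) _) => // /collapsed.
  - move=> N; have [j ABj] := all_t _ (is_prefix_codeP (X 0) N).
    exists (cpair (prefix_code (X 0) N) j); rewrite cfstK csndK ABj eqxx.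
    exact: prefix_code_gt.
move=> /existsNP[t /not_implyP[Pt /forallNP nAB]].
pose z j := (A t j)./2.
(* The two images are distinct but equivalent, so they form a nontrivial class. *)
have zZ j : coded_prefixes X (z j).
  have : pair_rel (coded_join X) (w t j).*2 (w t j).*2.+1.
    by rewrite pair_rel_double joinE.
  by move/fP => /orP[/eqP/nAB//|/andP[_]].
have cz : rcomputes O 1 (fun v => z (nth 0 v 0)).
  by rewrite /z /A /w; computes; apply: computes_app1 => //; computes.
(* If [z i = z j], both images lie in one class, so [f] makes the even elements of the pairs for [i]
   and [j] equivalent, which forces [i = j]. *)
have inj_z : injective z.
  move=> i j zij.
  have /fP : pair_rel (coded_prefixes X) (A t i) (A t j).
    by rewrite /pair_rel -/(z i) zZ -/(z j) zij eqxx orbT.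
  rewrite /pair_rel !doubleK => /orP[/eqP/double_inj|/andP[/eqP + _]];
  by move=> [] /double_inj e; have := congr1 csnd e; rewrite !csndK.
pose T j := csnd (csnd (z j)); pose S j := cfst (csnd (z j)).
have [] := pselect (forall N, exists j, N < T j).
  move=> unbounded_T; exists 0; apply: turing_le_unbounded_prefixes unbounded_T.
    by apply/rcomputes1P; rewrite /T; computes.
  by move=> j _; have /and3P[] := zZ j.
move=> /existsNP[N /forallNP leN].
have {}leN j : T j <= N by rewrite leqNgt; apply/negP.
(* The default 0 hides the indices whose first component is not [k]. *)
have [] := pselect (exists k : nat, forall M, exists j, M < if cfst (z j) == k then S j else 0).
  move=> [k unbounded_S]; exists k; apply: turing_le_unbounded_prefixes unbounded_S.
    by apply/rcomputes1P; rewrite /S; computes.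
  by move=> j; case: (cfst (z j) =P k) => [<- _|//]; have /and3P[] := zZ j.
move=> /forallNP bounded_S; exfalso.
have /choice[M MP] : forall k, exists M, forall j,
    (if cfst (z j) == k then S j else 0) <= M.
  move=> k; have /existsNP[M /forallNP leM] := bounded_S k.
  by exists M => j; rewrite leqNgt; apply/negP.
(* The condition [k < t] turns the bound on [t] into one on [k], so the bounds [M k] have a finite
   maximum; then all components of [z j] are bounded, against injectivity. *)
have ltN j : cfst (z j) < N.+1.
  by have /and3P[/ltnW kt _ _] := zZ j; rewrite ltnS; exact: leq_trans kt (leN j).
have [j] := injective_unbounded inj_z (cpair N (cpair (\max_(k < N.+1) M k) N)).
rewrite ltnNge => /negP; apply.
rewrite -[z j]cpairK -[csnd (z j)]cpairK; apply: cpair_mono; first exact: ltN.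
apply: cpair_mono; last exact: leN.
have := MP (cfst (z j)) j; rewrite eqxx => /leq_trans; apply.
exact: (@leq_bigmax _ (fun k : 'I_N.+1 => M k) (Ordinal (ltN j))).
Qed.

(** * Turing degrees and the spectrum *)

Lemma turing_le_trans X Y Z : turing_le X Y -> turing_le Y Z -> turing_le X Z.
Proof. by move=> XY YZ; exact: computable_in_trans YZ XY. Qed.

Lemma degree_class_le d X Y : degree_class d X -> degree_class d Y -> turing_le X Y.
Proof.
by case: (degree_classP d) => D -> [XD _] [_ DY]; exact: turing_le_trans XD DY.
Qed.

Lemma degree_class_nonempty d : exists X, degree_class d X.
Proof.
have [X dX] := degree_classP d; exists X; rewrite dX.
have cX : turing_le X X by apply/rcomputes1P/computes_oracle/computes_var.
by split.
Qed.

Theorem theorem5p1 (A B : set degree) :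
  A !=set0 -> upward_closed A -> countable B -> is_basis B A ->
  exists R S : rel nat,
    [/\ equivalence_rel R, equivalence_rel S,
        no_infinite_class R, no_infinite_class S &
        bireducibility_spectrum R S = A].
Proof.
move=> [a Aa] _ /countable_injP[i inj_i] [_ defA].
have [b0 Bb0 _] : [set d | exists2 b, B b & degree_le b d] a by rewrite -defA.
(* [b] lists the basis along the injection [i], with [b0] filling the indices outside its range. *)
have /choice[b bP] : forall n, exists d, B d /\ (forall d', B d' -> i d' = n -> d = d').
  move=> n; case: (pselect (exists2 d, B d & i d = n)) => [[d Bd <-]|no_d].
    by exists d; split=> // d' Bd' /esym/inj_i; apply; rewrite inE.
  by exists b0; split=> // d' Bd' id'; case: no_d; exists d'.
have /choice[X XP] : forall n, exists X, degree_class (b n) X.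
  by move=> n; exact: degree_class_nonempty.
exists (pair_rel (coded_prefixes X)), (pair_rel (coded_join X)).
split; try exact: pair_rel_equivalence; try exact: pair_rel_no_infinite_class.
rewrite defA; apply/seteqP; split=> d /=.
  move=> [_ [f [D dD cf] fP]].
  have [k Xk] := coded_join_reduction_computes cf fP.
  by exists (b k); [have [] := bP k|exists (X k), D; split].
move=> [b' Bb' [X' [D [bX' dD X'D]]]].
(* The element [b'] appears at its own index, so [X (i b')] represents it. *)
have [_ /(_ _ Bb' erefl) be] := bP (i b').
have XD : turing_le (X (i b')) D.
  by apply: turing_le_trans X'D; apply: degree_class_le (XP _) _; rewrite be.
split.
  by have [f cf fP] := coded_prefixes_reducible X D; exists f => //; exists D.
have [f cf fP] := coded_join_reducible X (i b').
by exists f => //; exists D => //; exact: computable_in_trans XD cf.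
Qed.
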